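(* Let $k,s\in\mathbb{N}$. Then $M_{sk}^{(k)}=M_s^k$, where $M_s^k$ denotes the $k$-th power of $M_s$.
   Context: The Mersenne numbers $(M_n)_{n\ge 0}$ are defined by $M_0=0$, $M_1=1$, $M_{n+2}=3M_{n+1}-2M_n$ for $n\ge 0$. Let $\lambda_1=2$ and $\lambda_2=1$ be the roots of $\lambda^2-3\lambda+2=0$. For integers $n\ge 0$, $k\ge 1$, write uniquely $n=sk+r$ with integers $s\ge 0$ and $0\le r<k$; the generalized $k$-Mersenne number is $M_n^{(k)}=(\lambda_1^{s}-\lambda_2^{s})^{k-r}(\lambda_1^{s+1}-\lambda_2^{s+1})^{r}$. $\mathbb{N}$ denotes the positive integers. *)

(* Defs.v *)
From mathcomp Require Import all_boot all_order all_algebra.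

Set Implicit Arguments.
Unset Strict Implicit.
Unset Printing Implicit Defensive.

Import GRing.Theory.
Local Open Scope ring_scope.

Fixpoint mersenne (n : nat) : int :=
  if n is n1.+1 then
    if n1 is n2.+1 then 3 * mersenne n1 - 2 * mersenne n2 else 1
  else 0.

(* The roots of the characteristic equation x ^+ 2 - 3 * x + 2 = 0 of the
   recurrence defining mersenne. *)
Definition lambda1 : int := 2.
Definition lambda2 : int := 1.

(* M_n^(k), where s and r come from the Euclidean division n = s * k + r with
   r < k.  Meaningful only for 0 < k.  The subtraction k - r is in nat, and is
   never truncated when 0 < k. *)
Definition kmersenne (k n : nat) : int :=
  let s := (n %/ k)%N in
  let r := (n %% k)%N in
  (lambda1 ^+ s - lambda2 ^+ s) ^+ (k - r)
  * (lambda1 ^+ s.+1 - lambda2 ^+ s.+1) ^+ r.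

(* Main.v *)
Require Import Defs.
From mathcomp Require Import all_boot all_order all_algebra.
From mathcomp Require Import ring.

Import GRing.Theory.
Local Open Scope ring_scope.

(** At a multiple [s * k] of [k] the remainder vanishes, so the second factor
    of the generalized number disappears and what is left is the [k]-th power
    of [lambda1 ^+ s - lambda2 ^+ s].  By the Binet formula [mersenneE] the base
    of this power is the Mersenne number of index [s]; the usual denominator
    [lambda1 - lambda2] of that formula equals 1 here. *)

(** Both sides satisfy the same second-order recurrence, because [lambda1] and
    [lambda2] are roots of its characteristic polynomial, and they agree at
    indices 0 and 1. *)
Lemma mersenneE (n : nat) : mersenne n = lambda1 ^+ n - lambda2 ^+ n.
Proof.
(* The recurrence has order two, so the induction carries two consecutive
   indices. *)
suff: mersenne n = lambda1 ^+ n - lambda2 ^+ n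
   /\ mersenne n.+1 = lambda1 ^+ n.+1 - lambda2 ^+ n.+1 by case.
elim: n => [//|n [IHn IHn1]]; split=> //.
have -> : mersenne n.+2 = 3 * mersenne n.+1 - 2 * mersenne n by [].
by rewrite IHn IHn1 !exprS /lambda1 /lambda2; ring.
Qed.

Theorem proposition1 (k s : nat) (hk : (0 < k)%N) (hs : (0 < s)%N) :
  kmersenne k (s * k)%N = mersenne s ^+ k.
Proof.
by rewrite /kmersenne mulnK // modnMl subn0 expr0 mulr1 mersenneE.
Qed.
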